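(* If $G$ is a connected bipartite graph, then $\mathrm{vp}(G) \leq \alpha(G)$.
   Context: All graphs are finite, undirected and simple. $\alpha(G)$ denotes the independence number of $G$. A $u,v$-geodesic is a shortest $u,v$-path. For a vertex $x$ of $G$, a set $S \subseteq V(G)$ is an $x$-position set if for every $y \in S$ no vertex of $S \setminus \{y\}$ lies on any $x,y$-geodesic in $G$. The $x$-position number $p_x(G)$ is the maximum cardinality of an $x$-position set of $G$. Define $\mathrm{vp}(G) = \max_{x \in V(G)} p_x(G)$. *)

(* Defs.v *)
From mathcomp Require Import all_boot.
From mathcomp Require Import boolp.

Set Implicit Arguments.
Unset Strict Implicit.
Unset Printing Implicit Defensive.

Record sgraph := SGraph {
  vertex :> finType;
  edge : rel vertex;
  edge_sym : symmetric edge;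
  edge_irr : irreflexive edge
}.

(* The graph without vertices is not connected. *)
Definition connected_graph (G : sgraph) : Prop :=
  (0 < #|G|) /\ forall x y : G, connect (@edge G) x y.

Definition bipartite (G : sgraph) : Prop :=
  exists A : {set G}, forall x y : G, edge x y -> (x \in A) != (y \in A).

Definition independent (G : sgraph) (S : {set G}) : bool :=
  [forall x in S, forall y in S, ~~ edge x y].

Definition independence_number (G : sgraph) : nat :=
  \max_(S : {set G} | independent S) #|S|.

(* As in MathComp's [path], the vertices of the path are [x :: p]. *)
Definition uv_path (G : sgraph) (x y : G) (p : seq G) : bool :=
  [&& path (@edge G) x p, uniq (x :: p) & last x p == y].

Definition geodesic (G : sgraph) (x y : G) (p : seq G) : Prop :=
  uv_path x y p /\ forall q : seq G, uv_path x y q -> size p <= size q.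

Definition position_set (G : sgraph) (x : G) (S : {set G}) : Prop :=
  forall y, y \in S -> forall z, z \in S :\ y ->
    forall p : seq G, geodesic x y p -> z \notin x :: p.

Definition position_number (G : sgraph) (x : G) : nat :=
  \max_(S : {set G} | `[< position_set x S >]) #|S|.

Definition vertex_position_number (G : sgraph) : nat :=
  \max_(x : G) position_number x.

(* Main.v *)
Require Import Defs.
From mathcomp Require Import all_boot.
From mathcomp Require Import boolp.

(** In a connected bipartite graph every [x]-position set is independent: the
    ends of an edge [yz] have distances from [x] of different parity, hence
    differing by exactly one, so that the nearer end lies on a geodesic from
    [x] to the farther one. *)

Lemma geodesic_exists (G : sgraph) (x y : G) :
  connect (@edge G) x y -> exists p, geodesic x y p.
Proof.
move=> /connectP[p0 path_p0 ->].
(* Minimising over lengths, with tuples of a fixed length as candidates, keeps the predicate on [n]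
   boolean, as [ex_minnP] requires. *)
have ex_len : exists n, [exists t : n.-tuple G, uv_path x (last x p0) t].
  case/shortenP: path_p0 => p path_p uniq_p _.
  exists (size p); apply/existsP; exists (in_tuple p).
  by rewrite /uv_path path_p uniq_p eqxx.
case: (ex_minnP ex_len) => n /existsP[t uv_t] min_n.
exists t; split=> // q uv_q; rewrite size_tuple; apply: min_n.
by apply/existsP; exists (in_tuple q).
Qed.

(** Shortening the walk gives a path on some of its vertices, which by minimality is no shorter than
    [p]; hence the walk repeats no vertex. *)
Lemma shortest_walk_geodesic (G : sgraph) (x y : G) (p : seq G) :
  path (@edge G) x p -> last x p = y ->
  (forall q, uv_path x y q -> size p <= size q) -> geodesic x y p.
Proof.
move=> path_p last_p min_p; split=> //.
rewrite /uv_path path_p last_p eqxx andbT andTb.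
case/shortenP: (path_p) last_p => p' path_p' uniq_p' sub_p' last_p'.
apply: (leq_size_uniq uniq_p') => [z|].
  by rewrite !inE => /orP[->|/sub_p' ->]; rewrite ?orbT.
by rewrite ltnS; apply: min_p; rewrite /uv_path path_p' uniq_p' last_p' eqxx.
Qed.

Lemma bipartition_last (G : sgraph) (A : {set G}) (x : G) (p : seq G) :
  (forall u v : G, edge u v -> (u \in A) != (v \in A)) ->
  path (@edge G) x p -> (last x p \in A) = (x \in A) (+) odd (size p).
Proof.
move=> bipA; elim: p x => [|y p IHp] x /=; first by rewrite addbF.
by case/andP=> /bipA xy /IHp ->; case: (x \in A) (y \in A) xy => [] [] //=;
  case: odd.
Qed.

(** The extended walk has length [size p + 1], at most that of the geodesic [q], so it is shortest;
    that it does not already visit [z] follows from minimality. *)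
Lemma geodesic_rcons (G : sgraph) (x y z : G) (p q : seq G) :
  geodesic x y p -> geodesic x z q -> edge y z -> size p < size q ->
  geodesic x z (rcons p z).
Proof.
case=> /and3P[path_p _ /eqP last_p] _ [_ min_q] yz lt_pq.
apply: shortest_walk_geodesic; rewrite ?last_rcons ?rcons_path ?path_p ?last_p //.
by move=> r /min_q; rewrite size_rcons; apply: leq_trans.
Qed.

Lemma position_set_independent (G : sgraph) (x : G) (S : {set G}) :
  connected_graph G -> bipartite G -> position_set x S -> independent S.
Proof.
move=> [_ conn] [A bipA] posS.
apply/forall_inP => y Sy; apply/forall_inP => z Sz; apply/negP => yz.
have [p geo_p] := geodesic_exists _ _ _ (conn x y).
have [q geo_q] := geodesic_exists _ _ _ (conn x z).
wlog lt_pq : y z p q Sy Sz yz geo_p geo_q / size p < size q.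
  move=> wlog_lt; case: (ltngtP (size p) (size q)) => [lt_pq|lt_qp|eq_pq].
  - exact: (wlog_lt y z p q).
  - by apply: (wlog_lt z y q p); rewrite // edge_sym.
  (* Each edge switches sides, so equal lengths would put [y] and [z] on the same side of [A]. *)
  - case: geo_p geo_q => /and3P[path_p _ /eqP last_p] _.
    case=> /and3P[path_q _ /eqP last_q] _.
    have := bipA _ _ yz.
    by rewrite -last_p -last_q !(bipartition_last _ _ _ _ bipA) // eq_pq eqxx.
have neq_yz : y != z by apply: contraTneq yz => ->; rewrite edge_irr.
have ySz : y \in S :\ z by rewrite !inE neq_yz.
(* The contradiction comes from the position property at the farther end [z]: [y] is the last vertex
   of [x :: p], even when [p] is empty. *)
move: (posS z Sz y ySz _ (geodesic_rcons _ _ _ _ _ _ geo_p geo_q yz lt_pq)).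
case: geo_p => /and3P[_ _ /eqP <-] _.
by rewrite -rcons_cons mem_rcons inE mem_last orbT.
Qed.

Theorem theorem3p2 (G : sgraph) (hconn : connected_graph G) (hbip : bipartite G) :
  vertex_position_number G <= independence_number G.
Proof.
apply/bigmax_leqP => x _; apply/bigmax_leqP => S /asboolP posS.
apply: (@leq_bigmax_cond _ (@independent G) (fun S : {set G} => #|S|)).
exact: (position_set_independent _ _ _ hconn hbip posS).
Qed.
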